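(* Consider the single server G/G/1 queue under last come first serve scheduling with preemptive service (LCFSp), with fixed inter-generation time $X\sim F_X$, $\mathbb{E}[X]=1/\lambda$, $\lambda<\mu$. Let the service time $S$ be continuous with distribution $F_S$ depending on a parameter $\eta$, and suppose that for some $\eta^*$ and for all $x>0$: 1. $\mathbb{E}[S]=1/\mu$ for all $\eta$; 2. $\mathbb{E}[\mathbb{I}_{\{S>x\}}]\to0$ as $\eta\to\eta^*$; and 3. $\mathbb{E}[S\,\mathbb{I}_{\{S\le x\}}]\to0$ as $\eta\to\eta^*$. Then $$\lim_{\eta\to\eta^*}A^{\mathrm{ave}}_{\mathrm{G/G/1}}(F_S)=\frac12\frac{\mathbb{E}[X^2]}{\mathbb{E}[X]}.$$
   Context: Update packets $i=1,2,\dots$ are generated at times $t_1<t_2<\cdots$ of a renewal process with i.i.d. inter-generation times distributed as $X$. Service times are i.i.d. with distribution $F_S$, independent of the generation process. There is one server, serving one packet at a time; under LCFSp a newly generated packet immediately preempts any packet in service, so packet $i$ (with service time $S_i$) completes service before the next generation, $X_i$ time units later, if and only if $S_i<X_i$; preempted packets are not dropped but when delivered later they carry stale information. If packet $i$ reaches the destination at time $t_i'$ and $\mathcal{P}(t)$ is the set of packets received up to time $t$, the age is $A(t)=\min_{i\in\mathcal{P}(t)}(t-t_i)$ and the average age is $A^{\mathrm{ave}}=\limsup_{T\to\infty}\mathbb{E}\left[\frac1T\int_0^TA(t)\,dt\right]$, denoted $A^{\mathrm{ave}}_{\mathrm{G/G/1}}(F_S)$ for this queue. $\mathbb{I}$ denotes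 an indicator; the dependence of $S$ and $F_S$ on $\eta$ is suppressed in the notation. *)

(* Defs.v *)
From HB Require Import structures.
From mathcomp Require Import all_boot all_order all_algebra.
From mathcomp Require Import all_classical all_reals all_analysis.

Set Implicit Arguments.
Unset Strict Implicit.
Unset Printing Implicit Defensive.

Import Order.TTheory GRing.Theory Num.Theory.
Import numFieldNormedType.Exports.
Local Open Scope classical_set_scope.
Local Open Scope ring_scope.

(* Product rule over every finite subfamily, the indices being listed without
   repetition by s. *)
Definition mutually_independent (R : realType) (d : measure_display)
    (T : measurableType d) (P : probability T R) (I : eqType)
    (Z : I -> {RV P >-> R}) : Prop :=
  forall (s : seq I) (B : I -> set R), uniq s ->
    (forall i, i \in s -> measurable (B i)) ->
    P (\bigcap_(i in [set` s]) (Z i @^-1` B i)) =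
    (\prod_(i <- s) P (Z i @^-1` B i))%E.

(* A realization of the input of a G/G/1 queue with inter-generation law FX
   and service law FS. Packets are numbered 1, 2, ...; X i (i >= 1) is the time
   between the generations of packets i and i.+1, and X 0 is the time of the
   first generation. S i is the service time of packet i; S 0 is unused. *)
Record gg1_input (R : realType)
    (FX FS : probability (measurableTypeR R) R) := GG1Input {
  gg1_disp : measure_display ;
  gg1_space : measurableType gg1_disp ;
  gg1_prob : probability gg1_space R ;
  gg1_X : nat -> {RV gg1_prob >-> R} ;
  gg1_S : nat -> {RV gg1_prob >-> R} ;
  gg1_X_gt0 : forall i w, 0 < gg1_X i w ;
  gg1_S_ge0 : forall i w, 0 <= gg1_S i w ;
  gg1_X_law : forall i (A : set (measurableTypeR R)), measurable A ->
    distribution gg1_prob (gg1_X i) A = FX A ;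
  gg1_S_law : forall i (A : set (measurableTypeR R)), measurable A ->
    distribution gg1_prob (gg1_S i) A = FS A ;
  gg1_indep : mutually_independent
    (fun k : nat + nat =>
       match k with inl i => gg1_X i | inr i => gg1_S i end)
}.

(* The content of the system is a stack of pairs (packet, residual service
   time) whose head is the packet in service. During a time x without any
   generation, a packet is completed iff its residual service time is strictly
   less than the time left before the next generation. *)

(* Packets completed during a time x starting at time t, with the completion
   times. *)
Fixpoint served (R : realType) (t x : R) (q : seq (nat * R)) : seq (nat * R) :=
  if q is (i, r) :: q' then
    if r < x then (i, t + r) :: served (t + r) (x - r) q' else [::]
  else [::].

(* Content of the system after a time x. *)
Fixpoint remaining (R : realType) (x : R) (q : seq (nat * R)) :
    seq (nat * R) :=
  if q is (i, r) :: q' then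
    if r < x then remaining (x - r) q' else (i, r - x) :: q'
  else [::].

Section sample_path.
Context (R : realType) (X S : nat -> R).

Definition generation_time (i : nat) : R := \sum_(k < i) X k.

(* Content of the system just after generation_time i. *)
Fixpoint lcfsp_stack (i : nat) : seq (nat * R) :=
  if i is j.+1 then (j.+1, S j.+1) :: remaining (X j) (lcfsp_stack j)
  else [::].

(* Packet i reaches the destination at time t'. *)
Definition received_at (i : nat) (t' : R) : Prop :=
  exists j, (i, t') \in served (generation_time j) (X j) (lcfsp_stack j).

Definition received (t : R) : set nat :=
  [set i | exists2 t', received_at i t' & t' <= t].

(* a0 is the age at time 0: initially the destination holds an update
   generated at time - a0, which fixes A(t) before the first reception and is
   older than every packet. *)
Definition age (a0 t : R) : R :=
  inf ([set t + a0] `|` [set t - generation_time i | i in received t]).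

End sample_path.

Definition average_age (R : realType)
    (FX FS : probability (measurableTypeR R) R) (Q : gg1_input FX FS)
    (a0 : R) : \bar R :=
  limf_esup (fun T : R =>
    \int[gg1_prob Q]_w
      ((T^-1)%:E *
       \int[lebesgue_measure]_(t in `[0%R, T])
         (age (gg1_X Q ^~ w) (gg1_S Q ^~ w) a0 t)%:E))%E
    (pinfty_nbhs R).

(* Main.v *)
Require Import Defs.
From HB Require Import structures.
From mathcomp Require Import all_boot all_order all_algebra.
From mathcomp Require Import all_classical all_reals all_analysis.
From mathcomp Require Import measurable_realfun lra ring.

Set Implicit Arguments.
Unset Strict Implicit.
Unset Printing Implicit Defensive.

Import Order.TTheory GRing.Theory Num.Theory.
Import numFieldNormedType.Exports.
Local Open Scope classical_set_scope.
Local Open Scope ring_scope.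

(* Write t_i for the i-th generation time and, on [t_i, t_i.+1), compare the age
   with t - t_i, the age that an instantaneous server would give. It is never
   smaller, so a Wald and renewal-reward argument gives the lower bound
   E[X^2] / (2 E[X]) for every service law.

   For the upper bound fix del > 0 and count only the packets with
   S_i <= del < X_i, which are delivered before the next generation. The excess
   over t - t_i is then at most the staleness G_i inherited from the past, and
   it lasts at most del + X_i 1[S_i > del]. The pair (t_i, G_i) is independent of
   (X_i, S_i), and G_i satisfies a contracting recursion as soon as
   q = P(S > del) and P(X <= del) add up to at most 1/2; hence the average age
   exceeds E[X^2] / (2 E[X]) by at most 2 (del + q E[X]). Let q tend to 0, then
   del. *)

(* Unlike ge0_le_integral, this assumes no measurability: the age is never shown
   to be measurable, neither in time nor on the sample space. *)
Lemma le_integral_nonneg d (T : measurableType d) (R : realType)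
    (mu : {measure set T -> \bar R}) (D : set T) (f g : T -> \bar R) :
  (forall x, D x -> 0 <= f x)%E -> (forall x, D x -> f x <= g x)%E ->
  (\int[mu]_(x in D) f x <= \int[mu]_(x in D) g x)%E.
Proof.
move=> f0 fg.
have g0 x : D x -> (0 <= g x)%E.
  by move=> Dx; apply: le_trans (fg _ Dx); exact: f0.
rewrite !ge0_integralE//; apply: ereal_sup_le => _ [h hf <-].
exists h => // x; apply: le_trans (hf x) _.
by rewrite /patch; case: ifPn => // /[!inE]; exact: fg.
Qed.

(** * Integrals of nonnegative real-valued functions *)

Section real_valued_integral.
Context {d} {T : measurableType d} {R : realType} (mu : {measure set T -> \bar R}).
Implicit Types f g : T -> R.

Lemma ge0_integralD_EFin f g :
  measurable_fun setT f -> (forall x, 0 <= f x) ->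
  measurable_fun setT g -> (forall x, 0 <= g x) ->
  (\int[mu]_x (f x + g x)%:E = \int[mu]_x (f x)%:E + \int[mu]_x (g x)%:E)%E.
Proof.
move=> mf f0 mg g0; under eq_integral do rewrite EFinD.
by apply: ge0_integralD => //; [move=> x _; rewrite lee_fin|exact/measurable_EFinP|
  move=> x _; rewrite lee_fin|exact/measurable_EFinP].
Qed.

Lemma ge0_integralM_EFin (k : R) f : 0 <= k ->
  measurable_fun setT f -> (forall x, 0 <= f x) ->
  (\int[mu]_x (k * f x)%:E = k%:E * \int[mu]_x (f x)%:E)%E.
Proof.
move=> k0 mf f0; under eq_integral do rewrite EFinM.
by apply: ge0_integralZl_EFin => //; [move=> x _; rewrite lee_fin|exact/measurable_EFinP].
Qed.

Lemma ge0_integral_sum_EFin (F : nat -> T -> R) n :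
  (forall i, measurable_fun setT (F i)) -> (forall i x, 0 <= F i x) ->
  (\int[mu]_x (\sum_(i < n) F i x)%:E = \sum_(i < n) \int[mu]_x (F i x)%:E)%E.
Proof.
move=> mF F0; under eq_integral do rewrite -sumEFin.
rewrite ge0_integral_sum//; first by move=> i; exact/measurable_EFinP.
by move=> i x _; rewrite lee_fin.
Qed.

End real_valued_integral.

(** * Independence of the past *)

Section independence.
Context {R : realType} {d : measure_display} {T : measurableType d}.
Context {P : probability T R} {I : eqType}.
Variable Z : I -> {RV P >-> R}.
Implicit Types (J : set I) (s : seq I) (B : I -> set R).

(** A pi-system generating the sigma-algebra of the [Z i] with [i] in [J]; the product rule applies
    directly to its sets. *)
Definition cylinders J : set (set T) :=
  [set E | exists s B, [/\ uniq s, (forall i, i \in s -> J i),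
     (forall i, i \in s -> measurable (B i)) &
     E = \bigcap_(i in [set` s]) (Z i @^-1` B i)]].

(** As a measurable type on [T], it lets ordinary measurability lemmas express dependence on the
    [Z i] with [i] in [J] only. *)
Definition past J := g_sigma_algebraType (cylinders J).

Lemma cylinders_measurable J : cylinders J `<=` measurable.
Proof.
move=> E [s [B [us sJ mB ->]]].
apply: fin_bigcap_measurable => //= i si.
by rewrite -[X in measurable X]setTI; apply: measurable_funP => //; exact: mB.
Qed.

Lemma cylindersI J : setI_closed (cylinders J).
Proof.
move=> E F [s [B [us sJ mB ->]]] [s' [B' [us' s'J mB' ->]]].
(* Padding with [setT] off its own list turns each intersection into a box over the concatenated
   list. *)
pose C i := (if i \in s then B i else setT) `&` (if i \in s' then B' i else setT).
exists (undup (s ++ s')), C; split.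
- exact: undup_uniq.
- by move=> i; rewrite mem_undup mem_cat => /orP[/sJ|/s'J].
- by move=> i _; apply: measurableI; case: ifPn => // ?; [exact: mB|exact: mB'].
- apply/seteqP; split=> [w [h h'] i /= _|w h].
    by split; case: ifPn => // ?; [exact: h|exact: h'].
  split=> i /= si.
    have /= := h i; rewrite mem_undup mem_cat si => /(_ isT).
    by rewrite /C si => -[].
  have /= := h i; rewrite mem_undup mem_cat si orbT => /(_ isT).
  by rewrite /C si => -[].
Qed.

Lemma cylindersT J : cylinders J setT.
Proof.
exists [::], (fun=> setT); split=> //.
by apply/seteqP; split=> // w _ i /=.
Qed.

Lemma measurable_past J (f : T -> R) :
  measurable_fun [set: past J] f -> measurable_fun [set: T] f.
Proof.
move=> mf _ B mB; have := mf measurableT B mB; rewrite /measurable /=.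
apply: smallest_sub; first exact: sigma_algebra_measurable.
exact: cylinders_measurable.
Qed.

Lemma measurable_past_Z J i : J i -> measurable_fun [set: past J] (Z i : T -> R).
Proof.
move=> Ji _ B mB; rewrite setTI; apply: sub_sigma_algebra.
exists [:: i], (fun=> B); split=> //.
- by move=> j /[!inE] /eqP ->.
- by apply/seteqP; split=> [w wB j /= /[!inE] /eqP ->|w /(_ i)] //=; apply; rewrite inE.
Qed.

Lemma measurable_past_sub J J' (f : T -> R) : J `<=` J' ->
  measurable_fun [set: past J] f -> measurable_fun [set: past J'] f.
Proof.
move=> JJ' mf _ B mB; have := mf measurableT B mB; rewrite /measurable /=.
apply: smallest_sub => [|E [s [D [us sJ mD ->]]]].
  exact: smallest_sigma_algebra.
apply: sub_sigma_algebra; exists s, D; split=> //.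
by move=> i /sJ /JJ'.
Qed.

Hypothesis indepZ : mutually_independent Z.

(** Both sides are finite measures in [E], and the product rule makes them agree on the pi-system of
    cylinders. *)
Lemma past_indep J k (E : set T) (B : set R) : ~ J k ->
  measurable (E : set (past J)) -> measurable B ->
  P (E `&` Z k @^-1` B) = (P E * P (Z k @^-1` B))%E.
Proof.
move=> Jk mE mB.
have mF : measurable (Z k @^-1` B).
  by rewrite -[X in measurable X]setTI; exact: measurable_funP.
have c_ge0 : (0 <= fine (P (Z k @^-1` B)))%R by rewrite fine_ge0.
pose c := NngNum c_ge0.
suff : mrestr P mF E = mscale c P E.
  rewrite -[LHS]/(P (_ `&` _)) -[RHS]/((fine (P (Z k @^-1` B)))%:E * P _)%E.
  by move=> ->; rewrite muleC fineK// fin_num_measure.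
apply: (@g_sigma_algebra_measure_unique _ R T (cylinders J)
  (@cylinders_measurable J) (fun=> setT) (fun=> @cylindersT J) _
  (mrestr P mF) (mscale c P) (@cylindersI J)) => //.
- by rewrite bigcup_const.
- move=> A [s [D [us sJ mD ->]]].
  have ks : k \notin s by apply/negP => /sJ.
  pose D' i := if i == k then B else D i.
  have D's i : i \in s -> D' i = D i.
    by move=> si; rewrite /D' ifN//; apply: contraNneq ks => <-.
  have us' : uniq (k :: s) by rewrite /= ks.
  have mD' i : i \in k :: s -> measurable (D' i).
    rewrite inE => /orP[/eqP->|si]; first by rewrite /D' eqxx.
    by rewrite D's//; exact: mD.
  have := indepZ us' mD'.
  have -> : \bigcap_(i in [set` k :: s]) (Z i @^-1` D' i) =
      \bigcap_(i in [set` s]) (Z i @^-1` D i) `&` Z k @^-1` B.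
    apply/seteqP; split=> [w h|w [h hk] i /=].
      split=> [i /= si|].
        by have := h i; rewrite /= inE si orbT D's//; exact.
      by have := h k; rewrite /= mem_head /D' eqxx; exact.
    rewrite inE => /orP[/eqP ->|si]; first by rewrite /D' eqxx.
    by rewrite D's//; exact: h.
  rewrite big_cons {1}/D' eqxx => H.
  rewrite -[LHS]/(P (_ `&` _)) -[RHS]/((fine (P (Z k @^-1` B)))%:E * P _)%E.
  rewrite H fineK ?fin_num_measure//; congr (_ * _)%E.
  rewrite indepZ//; apply: eq_big_seq => i si.
  by rewrite D's.
- move=> _; rewrite -[X in (X < _)%E]/(P (_ `&` _)) setTI.
  by rewrite (le_lt_trans (probability_le1 _ _))// ltry.
Qed.

(** By [past_indep] the joint law of [Y] and [Z k] is the product of their laws; Tonelli's theorem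
    then splits the integral. *)
Lemma past_indep_integral J k (Y : T -> R) (h : R -> R) : ~ J k ->
  measurable_fun [set: past J] Y -> (forall w, 0 <= Y w) ->
  measurable_fun setT h -> (forall x, 0 <= h x) ->
  (\int[P]_w (Y w * h (Z k w))%:E =
   \int[P]_w (Y w)%:E * \int[P]_w (h (Z k w))%:E)%E.
Proof.
move=> Jk mY Y0 mh h0.
have mYT := measurable_past mY.
have mYZ : measurable_fun setT (fun w => (Y w, Z k w)).
  by apply/measurable_fun_pairP; split.
pose V : {mfun T >-> R} := mfun_Sub (mem_set mYT).
pose W : {mfun T >-> (R * R)%type} :=
  mfun_Sub (mem_set mYZ).
(* The absolute value makes the integrand nonnegative on the whole plane and changes nothing at the
   values of [Y]. *)
pose f0 (z : R * R) : R := `|z.1| * h z.2.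
have mf0 : measurable_fun setT f0.
  by apply: measurable_funM; exact: measurableT_comp.
have mf : measurable_fun [set: (R * R)%type] (EFin \o f0) by exact/measurable_EFinP.
have f_ge0 z : (0 <= (EFin \o f0) z)%E by rewrite lee_fin mulr_ge0.
transitivity (\int[distribution P W]_z (EFin \o f0) z)%E.
  rewrite ge0_integral_distribution//; apply: eq_integral => w _; rewrite /f0 /=.
  by rewrite ger0_norm.
transitivity (\int[distribution P V \x distribution P (Z k)]_z (EFin \o f0) z)%E.
  apply: eq_measure_integral => A mA _.
  apply/esym/product_measure_unique => // B C mB mC.
  have := @past_indep J k (Y @^-1` B) C Jk _ mC.
  by apply; rewrite -[X in measurable X]setTI; exact: mY.
rewrite fubini_tonelli1//.
have hZ0 : (0 <= \int[P]_w (h (Z k w))%:E)%E.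
  by apply: integral_ge0 => w _; rewrite lee_fin.
transitivity (\int[distribution P V]_x (`|x|%:E * \int[P]_w (h (Z k w))%:E))%E.
  apply: eq_integral => x _; rewrite /fubini_F /f0 /=.
  under eq_integral do rewrite EFinM.
  rewrite ge0_integralZl//; last 2 first.
  - exact/measurable_EFinP.
  - by move=> y _; rewrite lee_fin.
  congr (_ * _)%E; rewrite ge0_integral_distribution//.
  exact/measurable_EFinP.
rewrite ge0_integralZr//; last by apply/measurable_EFinP.
rewrite ge0_integral_distribution//; last by apply/measurable_EFinP.
congr (_ * _)%E; apply: eq_integral => w _ /=.
by rewrite ger0_norm.
Qed.

End independence.

(** * Sample paths *)

Section sample_path_bounds.
Context {R : realType} (X S : nat -> R).
Hypothesis X_gt0 : forall i, 0 < X i.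
Hypothesis S_ge0 : forall i, 0 <= S i.
Local Notation tg := (generation_time X).
Local Notation A := (age X S).

Lemma generation_time0 : tg 0 = 0.
Proof. by rewrite /generation_time big_ord0. Qed.

Lemma generation_timeS i : tg i.+1 = tg i + X i.
Proof. by rewrite /generation_time big_ord_recr. Qed.

Lemma le_generation_time i j : (i <= j)%N -> tg i <= tg j.
Proof.
elim: j => [|j IH]; first by rewrite leqn0 => /eqP ->.
rewrite leq_eqVlt => /predU1P[->//|]; rewrite ltnS => /IH /le_trans; apply.
by rewrite generation_timeS lerDl ltW.
Qed.

Lemma generation_time_ge0 i : 0 <= tg i.
Proof. by rewrite -generation_time0 le_generation_time. Qed.

Lemma remaining_all (j : nat) x (q : seq (nat * R)) :
  all (fun p => (p.1 <= j)%N && (0 <= p.2)) q ->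
  all (fun p => (p.1 <= j)%N && (0 <= p.2)) (remaining x q).
Proof.
elim: q x => [//|[k r] q IH] x /= /andP[/andP[kj r0] qj].
have [rx|xr] := ltP r x; first exact: IH.
by rewrite /= kj qj subr_ge0 xr.
Qed.

Lemma lcfsp_stack_all j :
  all (fun p => (p.1 <= j)%N && (0 <= p.2)) (lcfsp_stack X S j).
Proof.
elim: j => [//|j IH] /=; rewrite leqnn S_ge0 /=.
apply: remaining_all; apply: sub_all IH => p /andP[pj ->].
by rewrite (leq_trans pj)/=.
Qed.

Lemma served_bound (j k : nat) t t' x (q : seq (nat * R)) :
  all (fun p => (p.1 <= j)%N && (0 <= p.2)) q ->
  (k, t') \in served t x q -> (k <= j)%N /\ t <= t'.
Proof.
elim: q t x => [//|[i r] q IH] t x /= /andP[/andP[ij r0] qj].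
have [rx|xr] := ltP r x; last by [].
rewrite inE => /predU1P[[-> ->]|/(IH _ _ qj)[kj trt']].
  by rewrite lerDl.
by split => //; apply: le_trans trt'; rewrite lerDl.
Qed.

(** Causality: a packet that leaves during interval [j] was in the stack at [tg j]. *)
Lemma received_bound k t : received X S t k -> exists2 j, (k <= j)%N & tg j <= t.
Proof.
move=> [t' [j /(served_bound (lcfsp_stack_all j))[kj tj]] t't].
by exists j => //; exact: le_trans t't.
Qed.

(** A new packet enters at the head of the stack, so its service starts at once and ends before any
    preemption. *)
Lemma received_success k t : (0 < k)%N -> S k < X k -> tg k + S k <= t ->
  received X S t k.
Proof.
case: k => // k _ SX tS; exists (tg k.+1 + S k.+1) => //.
by exists k.+1; rewrite /= SX mem_head.
Qed.

Variable a0 : R.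
Hypothesis a0_ge0 : 0 <= a0.

Lemma age_has_lbound t : 0 <= t ->
  has_lbound ([set t + a0] `|` [set t - tg i | i in received X S t]).
Proof.
move=> t0; exists 0 => _ [->|[k /received_bound[j kj tj] <-]].
  exact: addr_ge0.
by rewrite subr_ge0; apply: le_trans tj; exact: le_generation_time.
Qed.

(** Before [tg i.+1] no packet numbered above [i] has been generated, and the initial update is at
    least as old as every packet. *)
Lemma age_ge t i : tg i <= t -> t < tg i.+1 -> t - tg i <= A a0 t.
Proof.
move=> tit tti; apply: lb_le_inf; first by exists (t + a0); left.
move=> _ [->|[k /received_bound[j kj tj] <-]].
  by rewrite lerD2l (le_trans _ a0_ge0)// oppr_le0 generation_time_ge0.
rewrite lerD2l lerN2; apply: le_generation_time; apply: leq_trans kj _.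
rewrite leqNgt; apply/negP => /le_generation_time titj.
by have := lt_le_trans tti (le_trans titj tj); rewrite ltxx.
Qed.

Lemma age_ge0 t : 0 <= t -> 0 <= A a0 t.
Proof.
move=> t0; apply: lb_le_inf; first by exists (t + a0); left.
move=> _ [->|[k /received_bound[j kj tj] <-]]; first exact: addr_ge0.
by rewrite subr_ge0; apply: le_trans tj; exact: le_generation_time.
Qed.

Lemma age_le_initial t : 0 <= t -> A a0 t <= t + a0.
Proof. by move=> t0; apply: ge_inf; [exact: age_has_lbound|left]. Qed.

Lemma age_le_received t k : 0 <= t -> received X S t k -> A a0 t <= t - tg k.
Proof.
by move=> t0 rk; apply: ge_inf; [exact: age_has_lbound|right; exists k].
Qed.

Variable del : R.

(* Packet 0 does not exist, so it counts as late. *)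
Definition late i : R := (i == 0%N)%:R + (del < S i)%R%:R.

(* An upper bound for the age at the generation of packet i, ignoring at the
   destination every packet k unless S k <= del < X k. *)
Fixpoint staleness i : R :=
  if i is j.+1 then X j + (late j + (X j <= del)%R%:R) * staleness j else a0.

Lemma late_ge0 i : 0 <= late i. Proof. by rewrite addr_ge0. Qed.

Lemma staleness_ge0 i : 0 <= staleness i.
Proof.
elim: i => [//|i IH] /=; apply: addr_ge0; first exact: ltW.
by rewrite mulr_ge0// addr_ge0// late_ge0.
Qed.

Lemma late_ge1 i : ~~ ((0 < i)%N && (S i <= del)) -> 1 <= late i.
Proof.
rewrite negb_and -ltNge lt0n negbK /late => /orP[->|->].
  by rewrite lerDl.
by rewrite lerDr.
Qed.

(** Induction on [i]. If [0 < i] and [S i <= del < X i], packet [i] arrives before [tg i.+1] and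
    resets the age; otherwise the factor of [staleness i] is at least 1 and the previous bound
    carries over. *)
Lemma age_le_staleness i t : tg i <= t -> A a0 t <= t - tg i + staleness i.
Proof.
elim: i => [|i IH] tit.
  by rewrite generation_time0 subr0; apply: age_le_initial; rewrite -generation_time0.
have t0 : 0 <= t := le_trans (generation_time_ge0 _) tit.
have tit' : tg i <= t := le_trans (le_generation_time (leqnSn _)) tit.
have Hs := staleness_ge0 i.
have Hl := late_ge0 i.
rewrite generation_timeS /=.
have [/andP[i0 Sdel]|/late_ge1 l1] := boolP ((0 < i)%N && (S i <= del)); last first.
  apply: le_trans (IH tit') _.
  suff : staleness i <= (late i + (X i <= del)%R%:R) * staleness i by lra.
  by rewrite ler_peMl// (le_trans l1)// lerDl.
have [Xdel|delX] := leP (X i) del.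
  apply: le_trans (IH tit') _.
  suff : staleness i <= (late i + 1) * staleness i by rewrite /=; lra.
  by rewrite ler_peMl// lerDr.
have := age_le_received t0 (received_success i0 (le_lt_trans Sdel delX) _).
rewrite generation_timeS in tit.
have -> : tg i + S i <= t by lra.
move=> /(_ isT) /le_trans; apply.
have : 0 <= (late i + 0) * staleness i by rewrite mulr_ge0// addr0.
by rewrite /=; lra.
Qed.

(** The excess due to a punctual packet ends by [tg i + del]: a later [t] in the interval gives
    [S i <= del <= t - tg i < X i], so the packet has been received. *)
Lemma age_le_interval i t : tg i <= t -> t < tg i.+1 ->
  A a0 t <= t - tg i + (late i + (t < tg i + del)%R%:R) * staleness i.
Proof.
move=> tit tti; have Hs := staleness_ge0 i; have Hl := late_ge0 i.
have t0 : 0 <= t := le_trans (generation_time_ge0 _) tit.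
have [/andP[i0 Sdel]|/late_ge1 l1] := boolP ((0 < i)%N && (S i <= del)); last first.
  apply: le_trans (age_le_staleness tit) _.
  by rewrite lerD2l ler_peMl// (le_trans l1)// lerDl.
have [tdel|delt] := ltP t (tg i + del).
  apply: le_trans (age_le_staleness tit) _.
  by rewrite lerD2l ler_peMl// lerDr.
rewrite generation_timeS in tti.
have SX : S i < X i by lra.
have tS : tg i + S i <= t by lra.
apply: le_trans (age_le_received t0 (received_success i0 SX tS)) _.
by rewrite lerDl mulr_ge0// addr0.
Qed.

End sample_path_bounds.

(** * Integrals of the teeth of a sawtooth *)

Section ramp.
Context {R : realType}.
Local Notation leb := (@lebesgue_measure R).

(** One tooth of the ideal age, extended by 0 so that teeth can be summed and integrated over the
    whole line. *)
Definition ramp (a b t : R) : R := \1_`[a, b[%classic t * (t - a).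

Lemma ramp_ge0 a b t : 0 <= ramp a b t.
Proof.
rewrite /ramp indicE mem_setE in_itv /=.
have [at_|ta] /= := leP a t; last by rewrite mul0r.
by rewrite mulr_ge0// subr_ge0.
Qed.

Lemma measurable_ramp a b : measurable_fun setT (ramp a b).
Proof.
apply: measurable_funM; first exact: measurable_indic.
exact: measurable_funB.
Qed.

Lemma integral_ramp a b : a <= b ->
  (\int[leb]_t (ramp a b t)%:E = ((b - a) ^+ 2 / 2)%:E)%E.
Proof.
rewrite le_eqVlt => /predU1P[->|ab].
  rewrite subrr expr0n mul0r; apply: integral0_eq => t _.
  by rewrite /ramp set_itvco0 // indic0 mul0r.
transitivity (\int[leb]_(t in `[a, b[) (t - a)%:E)%E.
  rewrite [RHS]integral_mkcond; apply: eq_integral => t _.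
  by rewrite /ramp /patch indicE; case: ifPn => _; rewrite ?mul1r ?mul0r.
rewrite integral_itv_bndo_bndc; last first.
  by apply/measurable_EFinP; apply: measurable_funB.
rewrite (@continuous_FTC2 _ _ (fun t => (t - a) ^+ 2 / 2))//.
- by rewrite -EFinB subrr expr0n mul0r subr0.
- apply: continuous_subspaceT => t; apply: cvgB; [exact: cvg_id|exact: cvg_cst].
- split.
  + by move=> x _; exact: ex_derive.
  + apply: cvg_at_right_filter; apply: cvgM; last exact: cvg_cst.
    by apply: cvgM; apply: cvgB;
      [exact: cvg_id|exact: cvg_cst|exact: cvg_id|exact: cvg_cst].
  + apply: cvg_at_left_filter; apply: cvgM; last exact: cvg_cst.
    by apply: cvgM; apply: cvgB;
      [exact: cvg_id|exact: cvg_cst|exact: cvg_id|exact: cvg_cst].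
- move=> x _; rewrite derive1E derive_val.
  by rewrite /GRing.scale /=; field.
Qed.

Lemma integral_itv_indic a b : a <= b ->
  (\int[leb]_t (\1_`[a, b[%classic t)%:E = (b - a)%:E)%E.
Proof.
move=> ab; rewrite integral_indic//= setIT lebesgue_measure_itv/= lte_fin.
by case: ltgtP ab => // ->; rewrite subrr.
Qed.

End ramp.

(** * Pathwise bounds on the time integral of the age *)

Section time_integral.
Context {R : realType} (X S : nat -> R).
Hypothesis X_gt0 : forall i, 0 < X i.
Hypothesis S_ge0 : forall i, 0 <= S i.
Variable a0 : R.
Hypothesis a0_ge0 : 0 <= a0.
Local Notation tg := (generation_time X).
Local Notation A := (age X S a0).
Local Notation leb := (@lebesgue_measure R).

(** The generation intervals are disjoint, so at most one term is positive, and none once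
    [tg n <= t]. *)
Lemma sum_itv_le n (F : nat -> R -> R) (a : R) t : 0 <= a ->
  (forall i, ~ (tg i <= t < tg i.+1) -> F i t <= 0) ->
  (forall i, tg i <= t < tg i.+1 -> F i t <= a) ->
  \sum_(i < n) F i t <= (t < tg n)%R%:R * a.
Proof.
move=> age0 F0 FA; elim: n => [|n IH]; first by rewrite big_ord0 mulr_ge0.
rewrite big_ord_recr /=; have tn := le_generation_time X_gt0 (leqnSn n).
have [ttn|tnt] := ltP t (tg n).
  rewrite (lt_le_trans ttn tn); rewrite ttn in IH.
  rewrite -[leRHS]addr0 lerD//; apply: F0 => /andP[].
  by rewrite leNgt ttn.
rewrite ltNge tnt /= mul0r in IH.
rewrite -[leRHS]add0r lerD//.
have [ttn|tnt'] := ltP t (tg n.+1); first by rewrite mul1r FA// tnt.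
by rewrite mul0r F0// => /andP[_]; rewrite ltNge tnt'.
Qed.

(* Truncating X i at c and asking for tg i <= T - c, instead of tg i.+1 <= T,
   keeps the i-th interval inside [0, T] by a condition which does not involve
   X i. *)
Lemma age_integral_ge n (c T : R) : 0 <= c ->
  ((\sum_(i < n) (tg i <= T - c)%R%:R * (Num.min (X i) c ^+ 2 / 2))%:E <=
   \int[leb]_(t in `[0%R, T]) (A t)%:E)%E.
Proof.
move=> c0.
pose m i := Num.min (X i) c.
have m0 i : 0 <= m i by rewrite le_min c0 (ltW (X_gt0 _)).
pose F i t := (tg i <= T - c)%R%:R * ramp (tg i) (tg i + m i) t.
have F0 i t : 0 <= F i t by rewrite mulr_ge0// ramp_ge0.
have mF i : measurable_fun setT (F i).
  by apply: measurable_funM => //; exact: measurable_ramp.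
apply: (@le_trans _ _ (\int[leb]_t (\sum_(i < n) F i t)%:E)%E); last first.
  rewrite [leRHS]integral_mkcond; apply: le_integral_nonneg => t _.
    by rewrite lee_fin sumr_ge0.
  have F_out i : ~ (tg i <= t < tg i.+1) -> F i t = 0.
    move=> /negP nt; rewrite /F /ramp indicE mem_setE in_itv /=.
    case: andP => [[tit tti]|_]; last by rewrite mul0r mulr0.
    move: nt; rewrite tit generation_timeS (lt_le_trans tti)//.
    by rewrite lerD2l ge_min lexx.
  rewrite patchE; case: ifPn => [|/negP tT]; last first.
    rewrite lee_fin; apply: sumr_le0 => i _; rewrite /F.
    have [tiT|_] := leP (tg i) (T - c); last by rewrite mul0r.
    rewrite /ramp indicE mem_setE in_itv /=.
    case: andP => [[tit tti]|_]; last by rewrite mul0r mulr0.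
    exfalso; apply: tT; rewrite inE /= in_itv /=.
    rewrite (le_trans (generation_time_ge0 X_gt0 i))//=.
    have : m i <= c by rewrite ge_min lexx orbT.
    by lra.
  rewrite inE /= in_itv /= => /andP[t0 tT]; rewrite lee_fin.
  have At0 := age_ge0 X_gt0 S_ge0 a0_ge0 t0.
  apply: (@le_trans _ _ ((t < tg n)%R%:R * A t)); last first.
    by rewrite ler_piMl// lern1 leq_b1.
  apply: sum_itv_le => // i => [/F_out -> //|/andP[tit tti]].
  apply: (@le_trans _ _ (t - tg i)); last exact: age_ge.
  have ti0 : 0 <= t - tg i by rewrite subr_ge0.
  rewrite /F /ramp mulrA ler_piMl// indicE -natrM lern1.
  by case: (_ <= _); case: (_ \in _).
rewrite ge0_integral_sum_EFin// -sumEFin; apply: lee_sum => i _.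
rewrite ge0_integralM_EFin//; [|exact: measurable_ramp|exact: ramp_ge0].
rewrite integral_ramp ?lerDl// [tg i + _]addrC addrK.
by rewrite EFinM.
Qed.

Variable del : R.
Hypothesis del_gt0 : 0 < del.
Local Notation G := (staleness X S a0 del).
Local Notation late := (late S del).

(** The bound [age_le_interval] is integrated over the intervals starting by [T]; their parts beyond
    [T] only enlarge it. If the first [n] intervals fail to cover [[0, T]], the crude bound [T + a0]
    takes over in the last term. *)
Lemma age_integral_le n (T : R) : 0 <= T ->
  (\int[leb]_(t in `[0%R, T]) (A t)%:E <=
  (\sum_(i < n) (tg i <= T)%R%:R *
     (X i ^+ 2 / 2 + (late i * X i + del) * G i) +
   (tg n <= T)%R%:R * (T * (T + a0)))%:E)%E.
Proof.
move=> T0.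
have G0 i : 0 <= G i := staleness_ge0 S X_gt0 a0_ge0 del i.
have l0 i : 0 <= late i := late_ge0 _ _ i.
(* A late packet is charged for its whole interval, and every packet for a window of length [del],
   which may overrun the interval. *)
pose F i t := (tg i <= T)%R%:R * (ramp (tg i) (tg i.+1) t +
  ((late i * G i) * \1_`[tg i, tg i.+1[%classic t +
   G i * \1_`[tg i, tg i + del[%classic t)).
have F0 i t : 0 <= F i t.
  by rewrite mulr_ge0// addr_ge0 ?ramp_ge0// addr_ge0// mulr_ge0// mulr_ge0.
have mI a b : measurable_fun [set: R] (\1_`[a, b[%classic : R -> R).
  exact: measurable_indic.
have mF i : measurable_fun setT (F i).
  apply: measurable_funM => //; apply: measurable_funD; first exact: measurable_ramp.
  by apply: measurable_funD; apply: measurable_funM => //.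
pose K t := ((tg n <= T)%R%:R * (T + a0)) * \1_`[0, T]%classic t.
have TK0 : 0 <= (tg n <= T)%R%:R * (T + a0) by rewrite mulr_ge0// addr_ge0.
have K0 t : 0 <= K t by rewrite mulr_ge0.
have mK : measurable_fun setT K.
  by apply: measurable_funM => //; exact: measurable_indic.
apply: (@le_trans _ _ (\int[leb]_t (\sum_(i < n) F i t + K t)%:E)%E).
  rewrite [leLHS]integral_mkcond; apply: le_integral_nonneg => t _.
    rewrite patchE; case: ifPn => //; rewrite inE /= in_itv /= => /andP[t0 _].
    by rewrite lee_fin age_ge0.
  rewrite patchE; case: ifPn => [|_]; last by rewrite lee_fin addr_ge0// sumr_ge0.
  rewrite inE /= in_itv /= => /andP[t0 tT]; rewrite lee_fin.
  have -> : K t = (tg n <= T)%R%:R * (T + a0).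
    by rewrite /K indicE mem_setE in_itv /= t0 tT mulr1.
  have [tnT|Ttn] := leP (tg n) T.
    rewrite mul1r (le_trans (age_le_initial X_gt0 S_ge0 a0_ge0 t0))//.
    by rewrite -[leLHS]add0r lerD ?sumr_ge0// lerD2r.
  rewrite mul0r addr0.
  have [i [ilt tit tti]] : exists i, [/\ (i < n)%N, tg i <= t & t < tg i.+1].
    have {tT} : t < tg n by exact: le_lt_trans Ttn.
    elim: (n) => [|k IH]; first by rewrite generation_time0 ltNge t0.
    have [tk _|kt tk] := ltP t (tg k); last by exists k.
    by have [i [ik ? ?]] := IH tk; exists i; split=> //; exact: ltnW.
  rewrite (bigD1 (Ordinal ilt))//= -[leLHS]addr0 lerD ?sumr_ge0//.
  apply: le_trans (age_le_interval X_gt0 S_ge0 a0_ge0 del tit tti) _.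
  rewrite /F (le_trans tit tT) mul1r /ramp !indicE !mem_setE !in_itv /= tit tti /=.
  by rewrite mul1r mulr1 mulrDl [_%:R * G i]mulrC.
rewrite ge0_integralD_EFin//; last 2 first.
- by apply: (@measurable_sum _ _ _ _ _ _ (fun i : 'I_n => F i)) => i.
- by move=> t; rewrite sumr_ge0.
rewrite ge0_integral_sum_EFin// EFinD -sumEFin; apply: leeD.
  apply: lee_sum => i _.
  rewrite ge0_integralM_EFin//; last 2 first.
  - apply: measurable_funD; first exact: measurable_ramp.
    by apply: measurable_funD; apply: measurable_funM => //.
  - by move=> t; rewrite addr_ge0 ?ramp_ge0// addr_ge0// mulr_ge0// mulr_ge0.
  rewrite EFinM; apply: lee_wpmul2l; first by rewrite lee_fin.
  have mD : measurable_fun setT (fun t => (late i * G i) * \1_`[tg i, tg i.+1[%classic t).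
    exact: measurable_funM.
  have mE : measurable_fun setT (fun t => G i * \1_`[tg i, tg i + del[%classic t).
    exact: measurable_funM.
  have D0 t : 0 <= (late i * G i) * \1_`[tg i, tg i.+1[%classic t.
    by rewrite mulr_ge0// mulr_ge0.
  have E0 t : 0 <= G i * \1_`[tg i, tg i + del[%classic t by rewrite mulr_ge0.
  rewrite ge0_integralD_EFin//; last 4 first.
  - exact: measurable_ramp.
  - exact: ramp_ge0.
  - exact: measurable_funD.
  - by move=> t; rewrite addr_ge0.
  rewrite ge0_integralD_EFin// !ge0_integralM_EFin// ?mulr_ge0//.
  have tt : tg i <= tg i.+1 := le_generation_time X_gt0 (leqnSn i).
  rewrite integral_ramp// !integral_itv_indic ?lerDl ?(ltW del_gt0)//.
  rewrite generation_timeS -!EFinM -!EFinD lee_fin.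
  by rewrite ![tg i + _]addrC !addrK; lra.
rewrite ge0_integralM_EFin//.
rewrite integral_indic//= setIT lebesgue_measure_itv/= lte_fin.
rewrite [T * _]mulrC mulrA [leRHS]EFinM; apply: lee_wpmul2l; first by rewrite lee_fin.
by case: ltP => // _; rewrite oppr0 adde0.
Qed.

End time_integral.

(** * Renewal theory *)

Section nonnegative_mean.
Context {d} {T : measurableType d} {R : realType} (P : probability T R).
Implicit Types (f g : T -> R) (a b : R).

(** Bundling measurability, sign and a finite mean lets expectations be handled as real numbers. *)
Definition nnmean f a :=
  [/\ measurable_fun setT f, (forall w, 0 <= f w) & (\int[P]_w (f w)%:E = a%:E)%E].

Lemma nnmean_ge0 f a : nnmean f a -> 0 <= a.
Proof.
by case=> _ f0 fa; rewrite -lee_fin -fa; apply: integral_ge0 => w _; rewrite lee_fin.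
Qed.

Lemma nnmean_le f g a b : nnmean f a -> nnmean g b -> (forall w, f w <= g w) -> a <= b.
Proof.
case=> _ f0 fa [_ _ gb] fg; rewrite -lee_fin -fa -gb.
by apply: le_integral_nonneg => w _; rewrite lee_fin.
Qed.

Lemma nnmean_dominated f g b : measurable_fun setT f -> (forall w, 0 <= f w) ->
  (forall w, f w <= g w) -> nnmean g b -> exists a, nnmean f a.
Proof.
move=> mf f0 fg [mg g0 gb]; exists (fine (\int[P]_w (f w)%:E)%E); split=> //.
rewrite fineK// ge0_fin_numE; last by apply: integral_ge0 => w _; rewrite lee_fin.
apply: (@le_lt_trans _ _ b%:E); last exact: ltry.
by rewrite -gb; apply: le_integral_nonneg => w _; rewrite lee_fin.
Qed.

Lemma nnmean_cst a : 0 <= a -> nnmean (fun=> a) a.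
Proof.
by move=> a0; split=> //; rewrite integral_cst//= probability_setT mule1.
Qed.

Lemma nnmeanD f g a b : nnmean f a -> nnmean g b ->
  nnmean (fun w => f w + g w) (a + b).
Proof.
case=> mf f0 fa [mg g0 gb]; split.
- exact: measurable_funD.
- by move=> w; rewrite addr_ge0.
- by rewrite ge0_integralD_EFin// fa gb.
Qed.

Lemma nnmeanM k f a : 0 <= k -> nnmean f a -> nnmean (fun w => k * f w) (k * a).
Proof.
move=> k0 [mf f0 fa]; split.
- exact: measurable_funM.
- by move=> w; rewrite mulr_ge0.
- by rewrite ge0_integralM_EFin// fa.
Qed.

Lemma nnmean_sum (f : nat -> T -> R) (a : nat -> R) n :
  (forall i, nnmean (f i) (a i)) ->
  nnmean (fun w => \sum_(i < n) f i w) (\sum_(i < n) a i).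
Proof.
move=> fa; elim: n => [|n IH].
  have -> : (fun w => \sum_(i < 0) f i w) = fun=> 0.
    by apply/funext => w; rewrite big_ord0.
  by rewrite big_ord0; exact: nnmean_cst.
have -> : (fun w => \sum_(i < n.+1) f i w) = fun w => \sum_(i < n) f i w + f n w.
  by apply/funext => w; rewrite big_ord_recr.
by rewrite big_ord_recr; apply: nnmeanD.
Qed.

Lemma eq_nnmean f g a b : f =1 g -> a = b -> nnmean f a -> nnmean g b.
Proof. by move=> /funext -> ->. Qed.

End nonnegative_mean.

Lemma measurable_leB {d} {T : measurableType d} {R : realType} (f : T -> R) (c : R) :
  measurable_fun setT f -> measurable_fun setT (fun w => (f w <= c)%R%:R : R).
Proof.
move=> mf; rewrite (_ : (fun _ => _) = (\1_`]-oo, c]%classic : R -> R) \o f).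
  by apply: measurableT_comp => //; exact: measurable_indic.
by apply/funext => w /=; rewrite indicE mem_setE in_itv.
Qed.

Lemma measurable_gtB {d} {T : measurableType d} {R : realType} (f : T -> R) (c : R) :
  measurable_fun setT f -> measurable_fun setT (fun w => (c < f w)%R%:R : R).
Proof.
move=> mf; rewrite (_ : (fun _ => _) = (\1_`]c, +oo[%classic : R -> R) \o f).
  by apply: measurableT_comp => //; exact: measurable_indic.
by apply/funext => w /=; rewrite indicE mem_setE in_itv /= andbT.
Qed.

(** * Arrival counts and Wald's identity *)

Section renewal.
Context {R : realType} {d} {T : measurableType d} {P : probability T R}.
Variables X S : nat -> {RV P >-> R}.
Let Z (k : nat + nat) : {RV P >-> R} :=
  match k with inl i => X i | inr i => S i end.
Hypothesis indepZ : mutually_independent Z.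
Hypothesis X_gt0 : forall i w, 0 < X i w.
Hypothesis S_ge0 : forall i w, 0 <= S i w.
Variable (FX FS : probability (measurableTypeR R) R).
Hypothesis X_law : forall i (A : set (measurableTypeR R)), measurable A ->
  distribution P (X i) A = FX A.
Hypothesis S_law : forall i (A : set (measurableTypeR R)), measurable A ->
  distribution P (S i) A = FS A.

(** These indices determine [tg i] and the staleness of packet [i], and leave out [X i] and
    [S i]. *)
Let J (i : nat) : set (nat + nat) :=
  [set k | match k with inl j => (j < i)%N | inr j => (j < i)%N end].

Local Notation tg i w := (generation_time (X ^~ w) i).

Definition arrived T0 i w : R := (tg i w <= T0)%R%:R.

Lemma law_integral (V : {RV P >-> R}) (F : probability (measurableTypeR R) R)
    (h : R -> R) :
  (forall A : set (measurableTypeR R), measurable A -> distribution P V A = F A) ->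
  measurable_fun [set: measurableTypeR R] h -> (forall x, 0 <= h x) ->
  (\int[P]_w (h (V w))%:E = \int[F]_x (h x)%:E)%E.
Proof.
move=> VF mh h0.
have mV : @measurable_fun _ _ T (measurableTypeR R) setT V.
  by move=> _ B mB; exact: measurable_funP.
pose V' : {mfun T >-> measurableTypeR R} :=
  @mfun_Sub _ _ T (measurableTypeR R) V (mem_set mV).
rewrite -[LHS](@ge0_integral_distribution _ _ _ _ _ P V' (EFin \o h))//.
- by apply: eq_measure_integral => A mA _; exact: VF.
- exact/measurable_EFinP.
Qed.

Lemma measurable_past_X i : measurable_fun [set: past Z (J i.+1)] (X i : T -> R).
Proof. exact: (@measurable_past_Z _ _ _ _ _ Z (J i.+1) (inl i) (ltnSn i)). Qed.

Lemma measurable_past_S i : measurable_fun [set: past Z (J i.+1)] (S i : T -> R).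
Proof. exact: (@measurable_past_Z _ _ _ _ _ Z (J i.+1) (inr i) (ltnSn i)). Qed.

Lemma past_mono i (f : T -> R) : measurable_fun [set: past Z (J i)] f ->
  measurable_fun [set: past Z (J i.+1)] f.
Proof. by apply: measurable_past_sub => -[] j /= ji; exact: ltnW. Qed.

(* Y is a function of the packets before i, so it is independent of X i and
   S i. *)
Lemma nnmean_past i (Y : T -> R) y (h k : R -> R) a b :
  measurable_fun [set: past Z (J i)] Y -> nnmean P Y y ->
  nnmean FX h a -> nnmean FS k b ->
  nnmean P (fun w => Y w * (h (X i w) * k (S i w))) (y * (a * b)).
Proof.
move=> mY [mYT Y0 Yy] [mh h0 ha] [mk k0 kb]; split.
- apply: measurable_funM => //; apply: measurable_funM; exact: measurableT_comp.
- by move=> w; rewrite !mulr_ge0.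
(* Independence is used twice: [S i] is split off from the past enlarged by [X i], then [X i] from
   the past alone. *)
pose J' : set (nat + nat) := [set c | J i c \/ c = inl i].
have mY' : measurable_fun [set: past Z J'] (fun w => Y w * h (X i w)).
  apply: measurable_funM.
    by apply: measurable_past_sub mY => c; left.
  apply: (measurableT_comp mh); apply: (@measurable_past_Z _ _ _ _ _ Z J' (inl i)).
  by right.
under eq_integral do rewrite mulrA.
rewrite (@past_indep_integral _ _ _ _ _ Z indepZ J' (inr i) _ k)//; last 2 first.
- by rewrite /J' /= ltnn => -[].
- by move=> w; rewrite mulr_ge0.
rewrite (@past_indep_integral _ _ _ _ _ Z indepZ (J i) (inl i) _ h)//; last first.
  by rewrite /= ltnn.
rewrite Yy (law_integral (X_law i) mh h0) (law_integral (S_law i) mk k0) ha kb.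
by rewrite -!EFinM mulrA.
Qed.

Lemma measurable_past_generation_time i :
  measurable_fun [set: past Z (J i)] (fun w => tg i w).
Proof.
elim: i => [|i IH].
  rewrite (_ : (fun _ => _) = fun=> 0)//.
  by apply/funext => w; rewrite generation_time0.
rewrite (_ : (fun _ => _) = fun w => tg i w + X i w); last first.
  by apply/funext => w; rewrite generation_timeS.
by apply: measurable_funD; [exact: past_mono|exact: measurable_past_X].
Qed.

Lemma measurable_past_arrived T0 i :
  measurable_fun [set: past Z (J i)] (arrived T0 i).
Proof.
apply: (@measurable_leB _ (past Z (J i))).
exact: measurable_past_generation_time.
Qed.

(** Summed over all [i], these probabilities give the renewal function at [T0], with index 0
    counted. *)
Definition arrival_prob T0 i : R := fine (\int[P]_w (arrived T0 i w)%:E)%E.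
Local Notation u := arrival_prob.

Lemma arrival_probP T0 i : nnmean P (arrived T0 i) (u T0 i).
Proof.
have a1 w : arrived T0 i w <= 1 by rewrite /arrived lern1 leq_b1.
have [||v hv] := nnmean_dominated _ _ a1 (nnmean_cst P ler01).
- exact: measurable_past (@measurable_past_arrived T0 i).
- by move=> w; rewrite /arrived.
- by have [? ? e] := hv; rewrite /u e.
Qed.

Lemma arrival_prob_ge0 T0 i : 0 <= u T0 i.
Proof. exact: nnmean_ge0 (arrival_probP T0 i). Qed.

Lemma arrivedS T0 i w : arrived T0 i.+1 w <= arrived T0 i w.
Proof.
rewrite /arrived generation_timeS; have := X_gt0 i w.
move=> X0; have [tT|//] := leP (tg i w + X i w) T0.
by have -> : tg i w <= T0 by lra.
Qed.

Lemma arrival_probS T0 i : u T0 i.+1 <= u T0 i.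
Proof.
exact: nnmean_le (arrival_probP T0 i.+1) (arrival_probP T0 i) (arrivedS T0 i).
Qed.

Lemma arrived_X_mean T0 i (h : R -> R) a : nnmean FX h a ->
  nnmean P (fun w => arrived T0 i w * h (X i w)) (u T0 i * a).
Proof.
move=> ha; have := nnmean_past (@measurable_past_arrived T0 i)
  (arrival_probP T0 i) ha (nnmean_cst FS ler01).
by apply: eq_nnmean => [w|]; rewrite mulr1.
Qed.

(** Since [tg i <= T0] is independent of [X i], the left side is the mean of a sum of truncated
    intervals; truncation limits the overshoot past [T0] to [c]. *)
Lemma renewal_upper T0 c mc n : 0 <= T0 -> 0 < c ->
  nnmean FX (fun x => Num.min `|x| c) mc ->
  (\sum_(i < n) u T0 i) * mc <= T0 + c.
Proof.
move=> T00 c0 hmc.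
have Tc : 0 <= T0 + c by rewrite addr_ge0// ltW.
have := nnmean_sum n (fun i => @arrived_X_mean T0 i _ _ hmc).
rewrite mulr_suml => /nnmean_le/(_ (nnmean_cst P Tc)); apply => w.
(* The bound by [tg n w] serves the induction: if [tg n w <= T0], the next term, at most [c], keeps
   the sum below [T0 + c]. *)
suff : \sum_(i < n) arrived T0 i w * Num.min `|X i w| c <= Num.min (tg n w) (T0 + c).
  by rewrite le_min => /andP[].
elim: n => [|n]; first by rewrite big_ord0 generation_time0 le_min lexx Tc.
rewrite big_ord_recr /= generation_timeS !le_min => /andP[IH1 IH2].
have X0 := X_gt0 n w.
have m0 : 0 <= Num.min (X n w) c by rewrite le_min !ltW.
have mX : Num.min (X n w) c <= X n w by rewrite ge_min lexx.
have mc' : Num.min (X n w) c <= c by rewrite ge_min lexx orbT.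
rewrite gtr0_norm//; have [tT|Tt] := leP (tg n w) T0.
  have -> : arrived T0 n w = 1 by rewrite /arrived tT.
  by rewrite !mul1r; apply/andP; split; lra.
have -> : arrived T0 n w = 0 by rewrite /arrived leNgt Tt.
by rewrite !mul0r !addr0 IH2 andbT; lra.
Qed.

(** Without truncation, the intervals started by [T0] cover [[0, T0]] as soon as [T0 < tg n]; the
    complementary event costs [T0 * u T0 n]. *)
Lemma renewal_lower T0 m n : 0 <= T0 -> nnmean FX (fun x => `|x|) m ->
  T0 * (1 - u T0 n) <= (\sum_(i < n) u T0 i) * m.
Proof.
move=> T00 hm.
have := nnmean_sum n (fun i => @arrived_X_mean T0 i _ _ hm).
have hl := nnmeanM T00 (arrival_probP T0 n).
move=> /(nnmeanD hl); rewrite mulr_suml mulrBr mulr1 lerBlDl => H.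
apply: (nnmean_le (nnmean_cst P T00) H) => w; rewrite {1}/arrived.
have [tT|Tt] := leP (tg n w) T0.
  by rewrite mulr1 lerDl sumr_ge0// => i _; rewrite mulr_ge0.
rewrite mulr0 add0r.
suff : Num.min (tg n w) T0 <= \sum_(i < n) arrived T0 i w * `|X i w|.
  by rewrite min_r// ltW.
elim: (n) => [|k]; first by rewrite big_ord0 generation_time0 ge_min lexx.
rewrite big_ord_recr /= generation_timeS; have X0 := X_gt0 k w.
rewrite gtr0_norm// => IH; have [tT|Tt'] := leP (tg k w) T0.
  have -> : arrived T0 k w = 1 by rewrite /arrived tT.
  rewrite (min_l tT) in IH.
  by rewrite mul1r ge_min; apply/orP; left; lra.
have -> : arrived T0 k w = 0 by rewrite /arrived leNgt Tt'.
rewrite (min_r (ltW Tt')) in IH.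
by rewrite mul0r addr0 ge_min IH orbT.
Qed.

(** The [u T0 i] are nonincreasing in [i], so [renewal_upper] bounds [n%:R * u T0 n] by
    [(T0 + c) / mc]. *)
Lemma arrival_prob_small T0 c mc e : 0 <= T0 -> 0 < c -> 0 < mc ->
  nnmean FX (fun x => Num.min `|x| c) mc -> 0 < e -> exists n, u T0 n <= e.
Proof.
move=> T00 c0 mc0 hmc e0.
pose n := Num.bound ((T0 + c) / mc / e).
have hn : (T0 + c) / mc / e < n%:R.
  by apply: archi_boundP; rewrite !divr_ge0 ?addr_ge0// ltW.
have n0 : 0 < n%:R :> R by apply: le_lt_trans hn; rewrite !divr_ge0 ?addr_ge0// ltW.
exists n; have := @renewal_upper T0 c mc n T00 c0 hmc.
rewrite -ler_pdivlMr// => hU.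
have nU : n%:R * u T0 n <= \sum_(i < n) u T0 i.
  elim: (n) => [|k IH]; first by rewrite mul0r big_ord0.
  rewrite big_ord_recr /= -natr1 mulrDl mul1r lerD ?arrival_probS//.
  by apply: le_trans IH; rewrite ler_wpM2l// arrival_probS.
rewrite -(ler_pM2l n0); apply: (le_trans nU); apply: (le_trans hU).
by rewrite -ler_pdivrMr// ltW.
Qed.

(** * Mean age over a finite horizon *)

Variable a0 : R.
Hypothesis a0_ge0 : 0 <= a0.

Definition mean_age T0 : \bar R :=
  (\int[P]_w ((T0^-1)%:E *
    \int[lebesgue_measure]_(t in `[0%R, T0]) (age (X ^~ w) (S ^~ w) a0 t)%:E))%E.

Lemma age_integral_ge0 T0 w :
  (0 <= \int[lebesgue_measure]_(t in `[0%R, T0]) (age (X ^~ w) (S ^~ w) a0 t)%:E)%E.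
Proof.
apply: integral_ge0 => t /=; rewrite in_itv /= => /andP[t0 _].
by rewrite lee_fin age_ge0.
Qed.

(* The probability that tg n <= T0 tends to 0, so the finite sums over i < n
   exhaust the interval [0, T0]. *)
Lemma mean_age_ge T0 c b m mc k :
  0 <= c -> c < T0 -> 0 < b -> 0 < m -> 0 < mc ->
  nnmean FX (fun x => `|x|) m ->
  nnmean FX (fun x => Num.min `|x| b) mc ->
  nnmean FX (fun x => Num.min `|x| c ^+ 2 / 2) k ->
  (((1 - c / T0) * (k / m))%:E <= mean_age T0)%E.
Proof.
move=> c0 cT b0 m0 mc0 hm hmc hk; have T0_gt0 : 0 < T0 by apply: le_lt_trans cT.
have T0c : 0 <= T0 - c by rewrite subr_ge0 ltW.
have k0 := nnmean_ge0 hk.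
apply/lee_addgt0Pr => e e0.
have bound n : ((T0^-1 * ((\sum_(i < n) u (T0 - c) i) * k))%:E <= mean_age T0)%E.
  have hn := nnmean_sum n (fun i => @arrived_X_mean (T0 - c) i _ _ hk).
  have Ti : 0 <= T0^-1 by rewrite invr_ge0 ltW.
  have [_ F0] := nnmeanM Ti hn; rewrite -mulr_suml => <-.
  apply: le_integral_nonneg => w _; first by rewrite lee_fin.
  rewrite EFinM; apply: lee_wpmul2l; first by rewrite lee_fin.
  apply: le_trans (age_integral_ge (X_gt0 ^~ w) (S_ge0 ^~ w) a0_ge0 n T0 c0).
  rewrite lee_fin; apply: ler_sum => i _.
  by rewrite gtr0_norm.
(* Adding 1 keeps the divisor positive even if [k = 0]; the loss [u (T0 - c) n * (k / m)] is then at
   most [e]. *)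
have d0 : 0 < 1 + k / m by rewrite ltr_wpDr// divr_ge0// ltW.
have [n un] := @arrival_prob_small (T0 - c) b mc (e / (1 + k / m)) T0c b0 mc0 hmc
  (divr_gt0 e0 d0).
apply: le_trans (leeD2r _ (bound n)); rewrite -EFinD lee_fin.
have := @renewal_lower (T0 - c) m n T0c hm; rewrite -ler_pdivrMr// => hU.
have {}hU : T0^-1 * ((T0 - c) * (1 - u (T0 - c) n) / m * k) <=
    T0^-1 * ((\sum_(i < n) u (T0 - c) i) * k).
  by rewrite ler_pM2l ?invr_gt0// ler_wpM2r.
rewrite -lerBlDr; apply: le_trans hU.
have -> : T0^-1 * ((T0 - c) * (1 - u (T0 - c) n) / m * k) =
    (1 - c / T0) * (k / m) - (1 - c / T0) * (u (T0 - c) n * (k / m)).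
  by field; rewrite !gt_eqF.
rewrite lerD2l lerN2.
have km0 : 0 <= k / m by rewrite divr_ge0// ltW.
have u0 := arrival_prob_ge0 (T0 - c) n.
apply: (@le_trans _ _ (1 * (u (T0 - c) n * (k / m)))).
  by apply: ler_wpM2r; [exact: mulr_ge0|rewrite lerBlDr lerDl divr_ge0// ltW].
rewrite mul1r; apply: (@le_trans _ _ (u (T0 - c) n * (1 + k / m))).
  by rewrite ler_wpM2l// lerDr.
by rewrite -ler_pdivlMr.
Qed.

Variable del : R.
Hypothesis del_gt0 : 0 < del.
Local Notation G i w := (staleness (X ^~ w) (S ^~ w) a0 del i).

(** The indicator lets the sum of the means be controlled by the sum of the [u T0 i]. *)
Definition arrived_stale T0 i w : R := arrived T0 i w * G i w.
Local Notation AG := arrived_stale.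

Lemma measurable_past_stale T0 i : measurable_fun [set: past Z (J i)] (AG T0 i).
Proof.
apply: measurable_funM; first exact: measurable_past_arrived.
elim: i => [|i IH] //=.
have mX := @measurable_past_X i.
apply: measurable_funD => //; apply: measurable_funM; last exact: past_mono.
apply: measurable_funD; last exact: (@measurable_leB _ (past Z (J i.+1))).
apply: measurable_funD => //.
by apply: (@measurable_gtB _ (past Z (J i.+1))); exact: measurable_past_S.
Qed.

Lemma arrived_stale_ge0 T0 i w : 0 <= AG T0 i w.
Proof. by rewrite mulr_ge0// staleness_ge0. Qed.

Variables m q r : R.
Hypothesis hm : nnmean FX (fun x => `|x|) m.
Hypothesis hq : nnmean FS (fun s => (del < s)%R%:R) q.
Hypothesis hr : nnmean FX (fun x => (x <= del)%R%:R) r.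

(** The staleness recursion expanded into products of a past quantity, a function of [X i] and a
    function of [S i]; the factors 1 match the shape of [nnmean_past]. *)
Let step T0 i w : R := arrived T0 i w * `|X i w| +
  ((i == 0%N)%:R * AG T0 i w +
   (AG T0 i w * (1 * (del < S i w)%R%:R) + AG T0 i w * ((X i w <= del)%R%:R * 1))).

(** Passing from [arrived T0 i.+1] to the larger [arrived T0 i] frees the indicator from [X i]. *)
Lemma arrived_stale_step T0 i w : AG T0 i.+1 w <= step T0 i w.
Proof.
have H : AG T0 i.+1 w <= arrived T0 i w * G i.+1 w.
  by rewrite ler_wpM2r ?arrivedS// staleness_ge0.
apply: (le_trans H); rewrite /step /arrived_stale /= /late gtr0_norm//.
by rewrite le_eqVlt; apply/orP; left; apply/eqP; ring.
Qed.

Lemma step_nnmean T0 i g : nnmean P (AG T0 i) g ->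
  nnmean P (step T0 i)
    (u T0 i * m + ((i == 0%N)%:R * g + (g * (1 * q) + g * (r * 1)))).
Proof.
move=> hg; apply: nnmeanD; first exact: arrived_X_mean.
apply: nnmeanD; first exact: nnmeanM.
have past_G := @measurable_past_stale T0 i.
apply: nnmeanD.
  exact: (nnmean_past past_G hg (nnmean_cst FX ler01) hq).
exact: (nnmean_past past_G hg hr (nnmean_cst FS ler01)).
Qed.

Definition stale_mean T0 i : R := fine (\int[P]_w (AG T0 i w)%:E)%E.
Local Notation g := stale_mean.

(** Finiteness propagates along the recursion by domination. *)
Lemma stale_meanP T0 i : nnmean P (AG T0 i) (g T0 i).
Proof.
suff [a ha] : exists a, nnmean P (AG T0 i) a.
  by have [? ? e] := ha; rewrite /g e.
have mAG j := measurable_past (@measurable_past_stale T0 j).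
elim: i => [|i [a /step_nnmean ha]].
  apply: nnmean_dominated (nnmean_cst P a0_ge0) => //; first exact: arrived_stale_ge0.
  by move=> w; rewrite /arrived_stale /= ler_piMl// lern1 leq_b1.
apply: nnmean_dominated ha => //; first exact: arrived_stale_ge0.
exact: arrived_stale_step.
Qed.

Lemma stale_mean_ge0 T0 i : 0 <= g T0 i.
Proof. exact: nnmean_ge0 (stale_meanP T0 i). Qed.

Lemma stale_mean0 T0 : g T0 0 <= a0.
Proof.
apply: nnmean_le (stale_meanP T0 0) (nnmean_cst P a0_ge0) _ => w.
by rewrite /arrived_stale /= ler_piMl// lern1 leq_b1.
Qed.

Lemma stale_meanS T0 i :
  g T0 i.+1 <= u T0 i * m + ((i == 0%N)%:R + (q + r)) * g T0 i.
Proof.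
have := nnmean_le (stale_meanP T0 i.+1) (step_nnmean (stale_meanP T0 i))
  (arrived_stale_step T0 i).
by move/le_trans; apply; rewrite le_eqVlt; apply/orP; left; apply/eqP; ring.
Qed.

(** Summing [stale_meanS] puts [q + r] times the same sum on the right, where half of the left side
    absorbs it. The initial age enters twice because packet 0 counts as late, so the first step does
    not contract. *)
Lemma stale_mean_sum T0 n : q + r <= 1 / 2 ->
  \sum_(i < n) g T0 i <= 2 * (2 * a0 + (\sum_(i < n) u T0 i) * m).
Proof.
move=> qr.
have sum_g0 : 0 <= \sum_(i < n) g T0 i.
  by apply: sumr_ge0 => i _; exact: stale_mean_ge0.
suff : \sum_(i < n.+1) g T0 i <= a0 + (n != 0%N)%:R * a0 +
    (\sum_(i < n) u T0 i) * m + (q + r) * \sum_(i < n) g T0 i.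
  rewrite big_ord_recr /=; have := stale_mean_ge0 T0 n.
  have : (n != 0%N)%:R * a0 <= a0 by rewrite ler_piMl// lern1 leq_b1.
  have : (q + r) * \sum_(i < n) g T0 i <= 1 / 2 * \sum_(i < n) g T0 i.
    by rewrite ler_wpM2r.
  by lra.
elim: (n) => [|k IH].
  rewrite big_ord_recr !big_ord0 /= !mul0r mulr0 !addr0 add0r.
  exact: stale_mean0.
rewrite big_ord_recr /= [in leRHS]big_ord_recr /=.
rewrite [X in _ <= _ + (q + r) * X]big_ord_recr /=.
have := stale_meanS T0 k; have := stale_mean0 T0; move: IH.
by case: k => [|k] /=; rewrite ?mul1r ?mul0r ?add0r; lra.
Qed.

(** In the mean of [age_integral_le] each product splits by independence; [renewal_upper] and
    [stale_mean_sum] bound the sums, and the term for [tg n <= T0] vanishes as [n] grows. *)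
Lemma mean_age_le T0 c mc e2 : 0 < T0 -> 0 < c -> 0 < mc -> q + r <= 1 / 2 ->
  nnmean FX (fun x => Num.min `|x| c) mc ->
  nnmean FX (fun x => x ^+ 2 / 2) e2 ->
  (mean_age T0 <= ((e2 + 2 * (del + q * m) * m) / mc +
     ((e2 + 2 * (del + q * m) * m) * c / mc + a0 * m +
       4 * (del + q * m) * a0) / T0)%:E)%E.
Proof.
move=> T0_gt0 c0 mc0 qr hmc he2.
have T00 := ltW T0_gt0; have m0 := nnmean_ge0 hm; have q0 := nnmean_ge0 hq.
have e20 := nnmean_ge0 he2.
have K0 : 0 <= T0 * (T0 + a0) by rewrite mulr_ge0// addr_ge0.
have Ti : 0 <= T0^-1 by rewrite invr_ge0.
have kap0 : 0 <= del + q * m by rewrite addr_ge0 ?mulr_ge0// ltW.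
have bound n : (mean_age T0 <= (T0^-1 * (\sum_(i < n) (u T0 i * e2 +
    ((i == 0%N :> nat)%:R * (g T0 i * (m * 1)) + (g T0 i * (m * q) + del * g T0 i))) +
    (T0 * (T0 + a0)) * u T0 n))%:E)%E.
  pose F i w : R := arrived T0 i w * (X i w ^+ 2 / 2) +
    ((i == 0%N)%:R * (AG T0 i w * (`|X i w| * 1)) +
     (AG T0 i w * (`|X i w| * (del < S i w)%R%:R) + del * AG T0 i w)).
  have hF i : nnmean P (F i) (u T0 i * e2 +
      ((i == 0%N)%:R * (g T0 i * (m * 1)) + (g T0 i * (m * q) + del * g T0 i))).
    have past_G := @measurable_past_stale T0 i.
    have hg := stale_meanP T0 i.
    apply: nnmeanD; first exact: (arrived_X_mean T0 i he2).
    apply: nnmeanD.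
      by apply: nnmeanM => //; exact: (nnmean_past past_G hg hm (nnmean_cst FS ler01)).
    apply: nnmeanD; first exact: (nnmean_past past_G hg hm hq).
    by apply: nnmeanM => //; exact: ltW.
  have [_ _ <-] := nnmeanM Ti (nnmeanD (nnmean_sum n hF)
    (nnmeanM K0 (arrival_probP T0 n))).
  apply: le_integral_nonneg => w _.
    by rewrite mule_ge0 ?lee_fin// age_integral_ge0.
  rewrite EFinM; apply: lee_wpmul2l; first by rewrite lee_fin.
  apply: (le_trans (age_integral_le (X_gt0 ^~ w) (S_ge0 ^~ w) a0_ge0 del_gt0 n T00)).
  rewrite lee_fin le_eqVlt; apply/orP; left; apply/eqP.
  rewrite [X in _ + X]mulrC; congr (_ + _); apply: eq_bigr => i _.
  by rewrite /F /arrived_stale /late /arrived gtr0_norm//; ring.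
apply/lee_addgt0Pr => e e0.
have d0 : 0 < T0 + a0 by rewrite ltr_wpDr.
have [n un] := @arrival_prob_small T0 c mc (e / (T0 + a0)) T00 c0 mc0 hmc
  (divr_gt0 e0 d0).
apply: (le_trans (bound n)); rewrite -EFinD lee_fin.
have := @renewal_upper T0 c mc n T00 c0 hmc; rewrite -ler_pdivlMr// => hU.
have hg := stale_mean_sum T0 n qr.
(* Only packet 0 contributes, being late by convention. *)
have h0 : \sum_(i < n) (i == 0%N :> nat)%:R * (g T0 i * (m * 1)) <= a0 * m.
  case: (n) => [|k]; first by rewrite big_ord0 mulr_ge0.
  rewrite big_ord_recl big1 ?addr0 => [|i _]; last by rewrite mul0r.
  by rewrite mul1r mulr1 ler_wpM2r// stale_mean0.
rewrite !big_split /= -!mulr_suml -mulr_sumr.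
have hu : (T0 + a0) * u T0 n <= e by rewrite mulrC -ler_pdivlMr.
set U := \sum_(i < n) u T0 i in hU hg *.
set V := \sum_(i < n) g T0 i in hg *.
(* [B] is the coefficient of [U] once [V] is replaced by its bound; the leftover [2 * (2 * a0)]
   gives the 4 in the statement. *)
set B := e2 + 2 * (del + q * m) * m.
set W := \sum_(i < n) _ in h0 *.
have hV : (del + q * m) * V <= (del + q * m) * (2 * (2 * a0 + U * m)).
  by rewrite ler_wpM2l.
have B0 : 0 <= B by rewrite addr_ge0 ?mulr_ge0.
have hB : B * U <= B * ((T0 + c) / mc) by rewrite ler_wpM2l.
rewrite mulrC ler_pdivrMr//.
have -> : (B / mc + (B * c / mc + a0 * m + 4 * (del + q * m) * a0) / T0 + e) * T0 =
    B * ((T0 + c) / mc) + a0 * m + 4 * (del + q * m) * a0 + e * T0.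
  by field; rewrite !gt_eqF.
have hu' : T0 * ((T0 + a0) * u T0 n) <= T0 * e by rewrite ler_pM2l.
rewrite /B in hB *.
lra.
Qed.

End renewal.

(** * Limits *)

Section truncation.
Context {R : realType} (F : probability (measurableTypeR R) R).

Lemma measurable_trunc (c : R) :
  measurable_fun [set: measurableTypeR R] (fun x : R => Num.min `|x| c).
Proof.
have : measurable_fun [set: R] (fun x : R => Num.min `|x| c).
  by apply: measurable_minr => //; exact: normr_measurable.
by move=> h; exact: h.
Qed.

(** Monotone convergence: at each point the truncated values are nondecreasing and eventually
    constant. The limit may be infinite. *)
Lemma trunc_mean_cvg (phi : R -> R) :
  measurable_fun [set: R] phi -> (forall x, 0 <= x -> 0 <= phi x) ->
  {in Num.nneg &, {homo phi : x y / x <= y}} ->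
  (\int[F]_x (phi (Num.min `|x| n%:R))%:E @[n --> \oo] -->
   \int[F]_x (phi `|x|)%:E)%E.
Proof.
move=> mphi phi0 phi_homo.
rewrite [X in _ --> X](_ : _ =
    (\int[F]_x (limn (fun n : nat => (phi (Num.min `|x| n%:R))%:E)))%E); last first.
  apply: eq_integral => x _; apply/esym/cvg_lim => //.
  apply: cvg_near_cst; near=> n; congr (phi _)%:E; apply: min_l.
  near: n; exists (Num.bound `|x|) => // n /= hn.
  by apply: ltW; apply: (lt_le_trans (archi_boundP _)) => //; rewrite ler_nat.
apply: (@cvg_monotone_convergence _ _ _ F setT measurableT
  (fun n x => (phi (Num.min `|x| n%:R))%:E)).
- move=> n; apply/measurable_EFinP; apply: (measurableT_comp mphi).
  exact: measurable_trunc.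
- by move=> n x _; rewrite lee_fin phi0// le_min normr_ge0 ler0n.
- move=> x _ n k nk; rewrite lee_fin; apply: phi_homo;
    rewrite ?nnegrE ?le_min ?normr_ge0 ?ler0n//.
  by rewrite ge_min lexx /= ge_min ler_nat nk orbT.
Unshelve. all: by end_near. Qed.

Lemma trunc_mean (phi : R -> R) (c : R) : 0 <= c ->
  measurable_fun [set: R] phi -> (forall x, 0 <= x -> 0 <= phi x) ->
  {in Num.nneg &, {homo phi : x y / x <= y}} ->
  nnmean F (fun x => phi (Num.min `|x| c))
    (fine (\int[F]_x (phi (Num.min `|x| c))%:E)%E).
Proof.
move=> c0 mphi phi0 phi_homo.
have [|||a [m0 h0 e]] := @nnmean_dominated _ _ _ F (fun x => phi (Num.min `|x| c))
  (fun=> phi c) (phi c) _ _ _ (nnmean_cst F (phi0 c c0)).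
- by apply: (measurableT_comp mphi); exact: measurable_trunc.
- by move=> x; rewrite phi0// le_min normr_ge0.
- by move=> x; apply: phi_homo; rewrite ?nnegrE ?le_min ?normr_ge0 ?c0// ge_min lexx orbT.
- by split=> //; rewrite e.
Qed.

End truncation.

Section limsup_at_infinity.
Context {R : realType}.
Implicit Types (f : R -> \bar R) (a k : R).

Lemma limf_esup_pinfty_ge f a k : 0 <= k ->
  (forall x, 0 < x -> k < x -> (a%:E - (k / x)%:E <= f x)%E) ->
  (a%:E <= limf_esup f (pinfty_nbhs R))%E.
Proof.
move=> k0 hf; rewrite limf_esupE; apply: le_ereal_inf_tmp => _ [V [M [_ MV]] <-].
apply/lee_addgt0Pr => e e0.
(* Exceeding [M] puts [x] in [V], exceeding [k] meets the hypothesis, and exceeding [k / e] makes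
   the error at most [e]. *)
pose x := `|M| + k + k / e + 1.
have ke : 0 <= k / e by rewrite divr_ge0// ltW.
have M0 := normr_ge0 M; have MM := ler_norm M.
have x0 : 0 < x by rewrite /x; lra.
have kx : k < x by rewrite /x; lra.
have xV : V x by apply: MV; rewrite /x; lra.
have kxe : k / x <= e.
  rewrite ler_pdivrMr// mulrC -ler_pdivrMr// /x; lra.
have := hf x x0 kx; rewrite -EFinB => H.
apply: (@le_trans _ _ (f x + e%:E)%E).
  by rewrite -leeBlDr// -EFinB; apply: le_trans H; rewrite lee_fin lerB.
by apply: leeD2r; apply: ereal_sup_ubound; exists x.
Qed.

Lemma limf_esup_pinfty_le f a k : 0 <= k ->
  (forall x, 0 < x -> (f x <= a%:E + (k / x)%:E)%E) ->
  (limf_esup f (pinfty_nbhs R) <= a%:E)%E.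
Proof.
move=> k0 hf; rewrite limf_esupE.
apply/lee_addgt0Pr => e e0.
have ke : 0 <= k / e by rewrite divr_ge0// ltW.
apply: (@le_trans _ _ (ereal_sup (f @` [set x | k / e < x]))).
  apply: ereal_inf_lbound; exists [set x | k / e < x] => //.
  by exists (k / e); split=> //; exact: num_real.
apply: ge_ereal_sup => _ [x /= kx <-].
have x0 : 0 < x by apply: le_lt_trans kx.
apply: (le_trans (hf x x0)); apply: leeD2l; rewrite lee_fin.
by rewrite ler_pdivrMr// mulrC -ler_pdivrMr// ltW.
Qed.

End limsup_at_infinity.

(** * Bounds on the average age as the horizon tends to infinity *)

Section average_age_bounds.
Context {R : realType} (FX FS : probability (measurableTypeR R) R).
Variables (Q : gg1_input FX FS) (a0 m : R).
Hypotheses (a0_ge0 : 0 <= a0) (m_gt0 : 0 < m).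
Hypothesis meanX : nnmean FX (fun x => `|x|) m.

Let mc n : R := fine (\int[FX]_x (Num.min `|x| n%:R)%:E)%E.

Let mcP n : nnmean FX (fun x => Num.min `|x| n%:R) (mc n).
Proof. by apply: (@trunc_mean _ FX id) => //; exact: measurable_id. Qed.

Let mc_cvg : mc n @[n --> \oo] --> m.
Proof.
have [_ _ em] := meanX.
have := @trunc_mean_cvg _ FX id (@measurable_id _ _ _) (fun x x0 => x0)
  (fun x y _ _ xy => xy).
by rewrite em => /fine_cvgP[].
Qed.

Let mc_gt0 : \forall n \near \oo, 0 < mc n.
Proof. exact: (cvgr_gt _ mc_cvg). Qed.

(** At a fixed truncation level [n], the limit in [T] leaves the truncated moment over [m]; monotone
    convergence in [n] restores the full moment, finite or not. *)
Lemma average_age_ge :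
  ((m^-1)%:E * \int[FX]_x (x ^+ 2 / 2)%:E <= average_age Q a0)%E.
Proof.
pose phi (x : R) := x ^+ 2 / 2.
have mphi : measurable_fun [set: R] phi.
  by apply: measurable_funM => //; exact: exprn_measurable.
have phi0 x : 0 <= x -> 0 <= phi x by move=> _; rewrite divr_ge0// sqr_ge0.
have phi_homo : {in Num.nneg &, {homo phi : x y / x <= y}}.
  by move=> x y; rewrite !nnegrE => x0 y0 xy; rewrite ler_wpM2r// lerXn2r.
have -> : (\int[FX]_x (x ^+ 2 / 2)%:E = \int[FX]_x (phi `|x|)%:E)%E.
  by apply: eq_integral => x _; rewrite /phi real_normK// num_real.
have := @cvgeZl _ _ _ _ _ (m^-1)%:E isT (@trunc_mean_cvg _ FX _ mphi phi0 phi_homo).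
move=> H; rewrite -(cvg_lim _ H)//.
apply: lime_le; first by apply/cvg_ex; eexists; exact: H.
near=> n.
have hk := @trunc_mean _ FX _ _ (ler0n R n) mphi phi0 phi_homo.
have [_ _ ek] := hk; rewrite ek; set k := fine _ in hk *.
have k0 := nnmean_ge0 hk.
rewrite -EFinM mulrC.
(* A second truncation level, with positive truncated mean, serves to make the arrival probabilities
   small. *)
have [b b0 mcb] : exists2 b : nat, (0 < b)%N & 0 < mc b.
  have [N _ hN] := mc_gt0; exists N.+1 => //; apply: hN => /=; exact: leqnSn.
have km0 : 0 <= k / m by rewrite divr_ge0// ltW.
(* The first summand is the loss from the factor [1 - n%:R / T]; the second restricts the claim to
   [T] above [n%:R]. *)
apply: (@limf_esup_pinfty_ge _ _ _ (n%:R * (k / m) + n%:R)).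
  by rewrite addr_ge0 ?ler0n// mulr_ge0 ?ler0n.
move=> T T0 kT.
have nT : n%:R < T by apply: le_lt_trans kT; rewrite lerDr mulr_ge0.
have bR : 0 < b%:R :> R by rewrite ltr0n.
apply: le_trans (mean_age_ge (gg1_indep Q) (@gg1_X_gt0 _ _ _ Q) (@gg1_S_ge0 _ _ _ Q)
  (@gg1_X_law _ _ _ Q) (@gg1_S_law _ _ _ Q) a0_ge0 (ler0n R n) nT bR m_gt0 mcb
  meanX (mcP b) hk).
rewrite -EFinB lee_fin mulrBl mul1r lerD2l lerN2 mulrAC.
by rewrite ler_wpM2r ?invr_ge0 ?(ltW T0)// lerDl.
Unshelve. all: by end_near. Qed.

(** For fixed [n] the limit in [T] leaves [B / mc n]; then [mc n] tends to [m]. *)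
Lemma average_age_le del q r e2 : 0 < del ->
  nnmean FS (fun s => (del < s)%R%:R) q ->
  nnmean FX (fun x => (x <= del)%R%:R) r -> q + r <= 1 / 2 ->
  nnmean FX (fun x => x ^+ 2 / 2) e2 ->
  (average_age Q a0 <= (e2 / m + 2 * (del + q * m))%:E)%E.
Proof.
move=> del0 hq hr qr he2.
have q0 := nnmean_ge0 hq; have e20 := nnmean_ge0 he2.
set B := e2 + 2 * (del + q * m) * m.
have kap0 : 0 <= del + q * m by rewrite addr_ge0 ?mulr_ge0// ltW.
have B0 : 0 <= B by rewrite addr_ge0// mulr_ge0 ?mulr_ge0// ltW.
have -> : e2 / m + 2 * (del + q * m) = B / m by rewrite /B; field; rewrite gt_eqF.
have H : (B / mc n)%:E @[n --> \oo] --> (B / m)%:E.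
  apply: cvg_EFin; first by near=> n.
  apply: cvgM; first exact: cvg_cst.
  by apply: cvgV => //; rewrite gt_eqF.
rewrite -(cvg_lim _ H)//; apply: lime_ge; first by apply/cvg_ex; eexists; exact: H.
near=> n.
have mcn : 0 < mc n by near: n; exact: mc_gt0.
have n0 : 0 < n%:R :> R by rewrite ltr0n; near: n; exists 1%N.
apply: (@limf_esup_pinfty_le _ _ _ (B * n%:R / mc n + a0 * m + 4 * (del + q * m) * a0)).
  rewrite addr_ge0 ?mulr_ge0// addr_ge0//; last by rewrite mulr_ge0// ltW.
  by rewrite divr_ge0 ?mulr_ge0// ltW.
move=> T T0; rewrite -EFinD.
exact: (mean_age_le (gg1_indep Q) (@gg1_X_gt0 _ _ _ Q) (@gg1_S_ge0 _ _ _ Q)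
  (@gg1_X_law _ _ _ Q) (@gg1_S_law _ _ _ Q) a0_ge0 del0 meanX hq hr T0 n0 mcn qr
  (mcP n) he2).
Unshelve. all: by end_near. Qed.

End average_age_bounds.

(** * The inter-generation law near zero *)

Section generation_law.
Context {R : realType} (FX FS : probability (measurableTypeR R) R).
Variable Q : gg1_input FX FS.

Lemma generation_law_gt0 : FX `]-oo, 0%R]%classic = 0%E.
Proof.
rewrite -(gg1_X_law Q 0); last exact: measurable_itv.
rewrite /distribution /pushforward [X in gg1_prob Q X](_ : _ = set0) ?measure0//.
by apply/seteqP; split=> // w /=; rewrite in_itv /= leNgt gg1_X_gt0.
Qed.

(** [FX] does not charge the nonpositive half-line. The absolute value supplies the nonnegativity
    everywhere that [nnmean] asks for. *)
Lemma mean_abs_generation : (\int[FX]_x `|x|%:E = 'E_FX[(fun x : R => x)])%E.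
Proof.
rewrite unlock.
have mI : measurable_fun [set: measurableTypeR R] (fun x : R => x).
  by have h : measurable_fun [set: R] (fun x : R => x) by []; exact: h.
have mN : measurable_fun [set: measurableTypeR R] (fun x : R => `|x|).
  by have h : measurable_fun [set: R] (fun x : R => `|x|) by []; exact: h.
apply: ae_eq_integral => //.
  exact/measurable_EFinP.
exists `]-oo, 0%R]%classic; split.
- exact: (@measurable_itv R).
- exact: generation_law_gt0.
- move=> x /= h; rewrite in_itv /= leNgt; apply/negP => x0; apply: h => _.
  by rewrite gtr0_norm.
Qed.

(** Continuity from above along half-lines that decrease to the null set of nonpositive reals. *)
Lemma generation_law_small e : 0 < e -> exists del r,
  [/\ 0 < del, del <= e, nnmean FX (fun x => (x <= del)%R%:R) r & r <= e].
Proof.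
move=> e0.
pose D n := `]-oo, n.+1%:R^-1]%classic : set (measurableTypeR R).
have DE n (x : R) : D n x = (x <= n.+1%:R^-1) :> Prop by rewrite /D set_itvE.
have D_cap : \bigcap_n D n = `]-oo, 0%R]%classic.
  apply/seteqP; split=> [x h|x /=].
    rewrite /= in_itv /=; apply/ler_addgt0Pr => y y0; rewrite add0r.
    have := h (Num.bound y^-1) I; rewrite DE => /le_trans; apply.
    rewrite invf_ple ?posrE//; apply: ltW; apply: (lt_le_trans (archi_boundP _)).
      by rewrite invr_ge0 ltW.
    by rewrite ler_nat.
  by rewrite in_itv /= => x0 n _; rewrite DE (le_trans x0)// invr_ge0.
have mD n : measurable (D n) by exact: (@measurable_itv R).
have : (FX \o D) x @[x --> \oo] --> FX (\bigcap_n D n).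
  apply: nonincreasing_cvg_mu => //.
  - by rewrite (le_lt_trans (probability_le1 _ _))// ltry.
  - by rewrite D_cap; exact: (@measurable_itv R).
  - move=> i j ij; apply/subsetPset => x; rewrite !DE => /le_trans; apply.
    by rewrite lef_pV2 ?posrE// ler_nat.
rewrite D_cap generation_law_gt0 => /fine_cvgP[_ /cvgr_le /(_ e e0)[N _ hN]].
have [k ke] : exists k : nat, k.+1%:R^-1 <= e.
  exists (Num.bound e^-1); rewrite invf_ple ?posrE//; apply: ltW.
  apply: (lt_le_trans (archi_boundP _)); first by rewrite invr_ge0 ltW.
  by rewrite ler_nat.
pose n := maxn N k.
exists n.+1%:R^-1, (fine (FX (D n))); split.
- by rewrite invr_gt0.
- by apply: le_trans ke; rewrite lef_pV2 ?posrE// ler_nat ltnS leq_maxr.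
- have -> : (fun x : measurableTypeR R => (x <= n.+1%:R^-1)%R%:R : R) = \1_(D n).
    by apply/funext => x; rewrite indicE mem_setE in_itv.
  split=> //.
  by rewrite integral_indic// setIT fineK// fin_num_measure.
- by apply: hN; rewrite /= leq_maxl.
Qed.

End generation_law.

(* eta ranges over a set D of a topological space H, so that etas may be finite
   or infinite (H = \bar R) and need not be an admissible value itself. *)
Theorem lemma2 (R : realType) (H : topologicalType) (D : set H) (etas : H)
    (lambda mu : R)
    (FX : probability (measurableTypeR R) R)
    (FS : H -> probability (measurableTypeR R) R)
    (Q : forall eta : H, gg1_input FX (FS eta))
    (a0 : R)
    (a0_ge0 : 0 <= a0)
    (lambda_gt0 : 0 < lambda)
    (lambda_lt_mu : lambda < mu)
    (meanX : 'E_FX[(fun x : R => x)]%E = (1 / lambda)%:E)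
    (S_continuous : forall eta, D eta ->
      continuous (fun x : R => FS eta `]-oo, x]%classic))
    (meanS : forall eta, D eta ->
      'E_(FS eta)[(fun s : R => s)]%E = (1 / mu)%:E)
    (S_tail : forall x : R, 0 < x ->
      'E_(FS eta)[(\1_`]x, +oo[ : R -> R)]%E @[eta --> within D etas^'] --> 0%E)
    (S_trunc : forall x : R, 0 < x ->
      'E_(FS eta)[(fun s : R => (s * \1_`]-oo, x] s)%R)]%E
        @[eta --> within D etas^'] --> 0%E) :
  average_age (Q eta) a0 @[eta --> within D etas^'] -->
    ((1 / 2)%:E *
     ('E_FX[(fun x : R => (x ^+ 2)%R)] / 'E_FX[(fun x : R => x)]))%E.
Proof.
pose m : R := lambda^-1.
have m0 : 0 < m by rewrite invr_gt0.
have mI : measurable_fun [set: measurableTypeR R] (fun x : R => `|x|).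
  by have h : measurable_fun [set: R] (fun x : R => `|x|) by []; exact: h.
have hm : nnmean FX (fun x => `|x|) m.
  by split=> //; rewrite (mean_abs_generation (Q etas)) meanX div1r.
have -> : ((1 / 2)%:E * ('E_FX[(fun x : R => (x ^+ 2)%R)] / 'E_FX[(fun x : R => x)]) =
    (m^-1)%:E * \int[FX]_x (x ^+ 2 / 2)%:E)%E.
  rewrite meanX (div1r lambda) -/m inver (gt_eqF m0) unlock muleA muleC; congr (_ * _)%E.
  rewrite -ge0_integralM_EFin//.
  - by apply: eq_integral => x _; rewrite mul1r mulrC.
  - by move=> x; exact: sqr_ge0.
set L := (_ * _)%E.
have low eta : (L <= average_age (Q eta) a0)%E by exact: average_age_ge.
have H0 : (0 <= \int[FX]_x (x ^+ 2 / 2)%:E)%E.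
  by apply: integral_ge0 => x _; rewrite lee_fin;
    exact: divr_ge0 (sqr_ge0 (x : R)) (ler0n R 2).
(* An infinite second moment makes the lower bound infinite, so the average age is constantly
   [+oo]. *)
have [He2|He2] := eqVneq (\int[FX]_x (x ^+ 2 / 2)%:E)%E +oo%E.
  have Ly : L = +oo%E by rewrite /L He2 gt0_muley// lte_fin invr_gt0.
  rewrite Ly (_ : (fun eta => average_age (Q eta) a0) = fun=> +oo%E).
    exact: cvg_cst.
  by apply/funext => eta; have := low eta; rewrite Ly leye_eq => /eqP.
pose e2 := fine (\int[FX]_x (x ^+ 2 / 2)%:E)%E.
have he2 : nnmean FX (fun x => x ^+ 2 / 2) e2.
  split.
  - have h : measurable_fun [set: R] (fun x : R => x ^+ 2 / 2).
      by apply: measurable_funM => //; exact: exprn_measurable.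
    exact: h.
  - by move=> x; exact: divr_ge0 (sqr_ge0 (x : R)) (ler0n R 2).
  - by rewrite fineK// ge0_fin_numE// lt_neqAle He2 leey.
have [_ _ Ee2] := he2.
have LE : L = (e2 / m)%:E by rewrite /L Ee2 -EFinM mulrC.
have up e : 0 < e -> \forall eta \near within D etas^',
    (average_age (Q eta) a0 <= (e2 / m + e)%:E)%E.
  move=> e0.
  (* [del] depends on [FX] and [e] alone, so the tail hypothesis applies at this fixed [del]. The
     thresholds give [q + r <= 1/4 + 1/4] and [2 * (del + q * m) <= 2 * (e/4 + e/4) = e]. *)
  have [|del [r [del0 dele hr re]]] := @generation_law_small _ _ _ (Q etas)
      (Num.min (1 / 4) (e / 4)).
    by rewrite lt_min; apply/andP; split; lra.
  have e4 : 0 < Num.min (1 / 4) (e / (4 * m)).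
    by rewrite lt_min; apply/andP; split; [lra|rewrite divr_gt0// mulr_gt0].
  have /fine_cvgP[_ /cvgr_le /(_ _ e4) hq] := S_tail del del0.
  near=> eta.
  have : fine 'E_(FS eta)[\1_`]del, +oo[ : R -> R] <= Num.min (1 / 4) (e / (4 * m)).
    by near: eta.
  set q := fine _ => hqe.
  have nq : nnmean (FS eta) (fun s => (del < s)%R%:R) q.
    have mD : measurable (`]del, +oo[%classic : set (measurableTypeR R)).
      exact: (@measurable_itv R).
    have -> : (fun s : measurableTypeR R => (del < s)%R%:R : R) = \1_`]del, +oo[%classic.
      by apply/funext => s; rewrite indicE mem_setE in_itv /= andbT.
    split=> //.
    by rewrite /q unlock fineK// integral_indic// setIT fin_num_measure.
  have q0 := nnmean_ge0 nq.
  move: re dele hqe; rewrite !le_min => /andP[r4 _] /andP[_ de] /andP[q4 qe].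
  have qr : q + r <= 1 / 2 by lra.
  apply: (le_trans (average_age_le (Q eta) a0_ge0 m0 hm del0 nq hr qr he2)).
  rewrite lee_fin lerD2l.
  have qm : q * m <= e / 4.
    have : q * m <= e / (4 * m) * m by rewrite ler_wpM2r// ltW.
    by rewrite (_ : e / (4 * m) * m = e / 4)//; field; rewrite gt_eqF.
  by lra.
(* Squeezed between [e2 / m] and [e2 / m + e], the average age is finite, and the limit reduces to
   one in the reals. *)
have fin e : 0 < e -> \forall eta \near within D etas^',
    average_age (Q eta) a0 \is a fin_num /\
    `|e2 / m - fine (average_age (Q eta) a0)| <= e.
  move=> e0; have := up e e0; apply: filterS => eta.
  have := low eta; rewrite LE.
  case: (average_age (Q eta) a0) => [a| |] //=; rewrite !lee_fin => la au.
  by split=> //; rewrite ler_distlC; apply/andP; split; lra.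
rewrite LE; apply/fine_cvgP; split.
  by have := fin 1 ltr01; apply: filterS => eta [].
by apply/cvgrPdist_le => e e0; have := fin e e0; apply: filterS => eta [].
Unshelve. all: by end_near. Qed.
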